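(* Consider a deterministic control problem on steps $S,\dots,T$ with value functions $V_k$ and conditional value functions $V_{k\to i}$ (defined in the context). Initialise the elements $a_k$, $k=S,\dots,T$, as $$a_k=V_{k\to k+1}(x_k,x_{k+1}),$$ where $V_{T\to T+1}(x_T,x_{T+1})$ is defined to be $V_T(x_T)$ (independent of $x_{T+1}$). Then, with $\otimes$ the associative operator defined in the context, $$a_S\otimes a_{S+1}\otimes\cdots\otimes a_{k-1}=V_{S\to k}(x_S,x_k)\qquad (k=S+1,\dots,T)$$ and $$a_k\otimes a_{k+1}\otimes\cdots\otimes a_T=V_k(x_k)\qquad (k=S,\dots,T),$$ where the last right-hand side is regarded as a function of $(x_k,x_{T+1})$ not depending on $x_{T+1}$.
   Context: Let $S<T$ be integers, $\mathcal X$ the state space (typically $\mathbb R^{n_x}$) and $\mathcal U$ the control space (typically $\mathbb R^{n_u}$). For $n=S,\dots,T-1$ let $f_n:\mathcal X\times\mathcal U\to\mathcal X$ and let $\ell_n:\mathcal X\times\mathcal U\to\mathbb R$ be bounded below; let $\ell_T:\mathcal X\to\mathbb R$ be bounded below. The dynamics are $x_{n+1}=f_n(x_n,u_n)$. Value function: $V_T(x_T)=\ell_T(x_T)$ and, for $k=T-1,\dots,S$, $V_k(x_k)=\min_{u_k}\{\ell_k(x_k,u_k)+V_{k+1}(f_k(x_k,u_k))\}$. Conditional value function, for $S\le k<i\le T$: $V_{k\to i}(x_k,x_i)=\min_{u_{k:i-1}}\sum_{n=k}^{i-1}\ell_n(x_n,u_n)$ subject to $x_n=f_{n-1}(x_{n-1},u_{n-1})$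 for all $n\in\{k+1,\dots,i\}$ with endpoints $x_k,x_i$ prescribed; it equals $\infty$ if no control sequence takes $x_k$ to $x_i$. Operator: for functions $V_a,V_b:\mathcal X\times\mathcal X\to(-\infty,+\infty]$ representing elements $a,b$, $a\otimes b$ is the function $(x,y)\mapsto\min_{z\in\mathcal X}\{V_a(x,z)+V_b(z,y)\}$; this operator is associative. Convention: $\min$ is read as the infimum in the extended reals ($+\infty$ over the empty set). *)

(* Defs.v *)
From HB Require Import structures.
From mathcomp Require Import all_boot all_order all_algebra.
From mathcomp Require Import boolp classical_sets reals ereal.

Set Implicit Arguments.
Unset Strict Implicit.
Unset Printing Implicit Defensive.

Import Order.TTheory GRing.Theory Num.Theory.
Local Open Scope classical_set_scope.
Local Open Scope ring_scope.

(* Every "min" is [ereal_inf], so it is [+oo] over the empty set.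
   Time steps are integers; data indexed by time is given by a function on all
   of [int], of which only the values at S, ..., T (or T - 1) are used. *)

Section ControlProblem.
Context {R : realType} {X U : Type}.
Variables (T : int) (f : int -> X -> U -> X).
Variables (ell : int -> X -> U -> R) (ellT : X -> R).

(* The backward recursion for V, indexed by the number m of remaining steps:
   [cost_to_go m] is V_{T - m}. *)
Fixpoint cost_to_go (m : nat) (x : X) : \bar R :=
  if m is m'.+1 then
    ereal_inf [set ((ell (T - m%:Z) x u)%:E
                    + cost_to_go m' (f (T - m%:Z) x u))%E | u in [set: U]]
  else (ellT x)%:E.

(* Meaningful for k <= T only. *)
Definition value (k : int) (x : X) : \bar R := cost_to_go `|T - k| x.

(* Pairs of a state sequence and a control sequence that obey the dynamics on
   the steps k, ..., i and join x to y; what the sequences do at other times is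
   irrelevant. *)
Definition admissible (k i : int) (x y : X) : set ((int -> X) * (int -> U)) :=
  [set su | [/\ su.1 k = x, su.1 i = y &
     forall n, k + 1 <= n <= i ->
       su.1 n = f (n - 1) (su.1 (n - 1)) (su.2 (n - 1))]].

(* The sum over n = k, ..., i - 1, written with n = k + j, 0 <= j < i - k. *)
Definition running_cost (k i : int) (su : (int -> X) * (int -> U)) : R :=
  \sum_(j < `|i - k|) ell (k + j%:Z) (su.1 (k + j%:Z)) (su.2 (k + j%:Z)).

(* Meaningful for k < i only. *)
Definition cond_value (k i : int) (x y : X) : \bar R :=
  ereal_inf [set (running_cost k i su)%:E | su in admissible k i x y].

Definition element (n : int) : X -> X -> \bar R :=
  if n == T then fun x _ => value T x else cond_value n (n + 1).

Lemma value_last x : value T x = (ellT x)%:E.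
Proof. by rewrite /value subrr. Qed.

Lemma value_rec k x : k < T ->
  value k x = ereal_inf [set ((ell k x u)%:E + value (k + 1) (f k x u))%E
                        | u in [set: U]].
Proof.
rewrite -subr_gt0 /value opprD addrA; case E: (T - k) => [[|m]|m] // _.
have -> : m.+1%:Z - 1 = m by rewrite intS addrC addKr.
by rewrite /= -E subKr.
Qed.

End ControlProblem.

Section Operator.
Context {R : realType} {X : Type}.

(* In [\bar R], [-oo + +oo] is [-oo]; this case does not arise for functions
   with values in (-oo, +oo]. *)
Definition otimes (a b : X -> X -> \bar R) : X -> X -> \bar R :=
  fun x y => ereal_inf [set (a x z + b z y)%E | z in [set: X]].

Fixpoint otimes_iter (a : int -> X -> X -> \bar R) (i : int) (m : nat) :
    X -> X -> \bar R :=
  if m is m'.+1 then otimes (otimes_iter a i m') (a (i + m%:Z)) else a i.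

(* a_i (x) a_{i+1} (x) ... (x) a_j for i <= j, associated to the left; by
   [otimesA] below the bracketing does not matter for functions that are
   bounded below, a property preserved by [otimes]. *)
Definition otimes_prod (a : int -> X -> X -> \bar R) (i j : int) :
    X -> X -> \bar R :=
  otimes_iter a i `|j - i|.

Definition bounded_below (a : X -> X -> \bar R) : Prop :=
  exists M : R, forall x y, (M%:E <= a x y)%E.

Lemma bounded_below_otimes a b :
  bounded_below a -> bounded_below b -> bounded_below (otimes a b).
Proof.
move=> [M aM] [N bN]; exists (M + N) => x y.
by apply: le_ereal_inf_tmp => _ [z _ <-]; rewrite EFinD leeD.
Qed.

Lemma addeinf (I : Type) (c : \bar R) (F : I -> \bar R) (M N : R) :
  (M%:E <= c)%E -> (forall i, N%:E <= F i)%E ->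
  (c + ereal_inf [set F i | i in [set: I]])%E
  = ereal_inf [set (c + F i)%E | i in [set: I]].
Proof.
move=> Mc NF; have NF' : (N%:E <= ereal_inf [set F i | i in [set: I]])%E.
  by apply: le_ereal_inf_tmp => _ [i _ <-].
have gtNy (e : \bar R) (r : R) : (r%:E <= e)%E -> e != -oo%E by case: e.
apply/le_anti/andP; split.
  apply: le_ereal_inf_tmp => _ [i _ <-]; apply: leeD => //.
  by apply: ereal_inf_lbound; exists i.
case: c Mc => [c||] // _; last by rewrite addye ?leey // (gtNy _ _ NF').
rewrite -leeBlDl //; apply: le_ereal_inf_tmp => _ [i _ <-].
by rewrite leeBlDl //; apply: ereal_inf_lbound; exists i.
Qed.

Lemma otimesA a b c : bounded_below a -> bounded_below b -> bounded_below c ->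
  otimes a (otimes b c) = otimes (otimes a b) c.
Proof.
move=> [M aM] [N bN] [P cP]; apply/funext => x; apply/funext => y.
rewrite /otimes.
have bcE z : (a x z + ereal_inf [set b z w + c w y | w in [set: X]])%E
    = ereal_inf [set (a x z + (b z w + c w y))%E | w in [set: X]].
  by apply: (addeinf (aM x z) (N := N + P)) => w; rewrite EFinD leeD.
have abE w : (ereal_inf [set a x z + b z w | z in [set: X]] + c w y)%E
    = ereal_inf [set (a x z + (b z w + c w y))%E | z in [set: X]].
  rewrite addeC (addeinf (cP w y) (N := M + N)); last first.
    by move=> z; rewrite EFinD leeD.
  by congr ereal_inf; apply: eq_imagel => z _; rewrite addeC addeA.
apply/le_anti/andP; split; apply: le_ereal_inf_tmp => _ [w _ <-].
  rewrite abE; apply: le_ereal_inf_tmp => _ [z _ <-].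
  apply: (@le_trans _ _ (a x z + ereal_inf [set b z w + c w y | w in setT])%E).
    by apply: ereal_inf_lbound; exists z.
  by rewrite bcE; apply: ereal_inf_lbound; exists w.
rewrite bcE; apply: le_ereal_inf_tmp => _ [z _ <-].
apply: (@le_trans _ _ (ereal_inf [set a x w + b w z | w in setT] + c z y)%E).
  by apply: ereal_inf_lbound; exists z.
by rewrite abE; apply: ereal_inf_lbound; exists w.
Qed.

End Operator.

(* Main.v *)
(** Both identities are Bellman recursions.  Cutting a trajectory from [S] to
    [k + 1] at time [k] gives V_{S->k+1} = V_{S->k} (x) a_k, which matches the
    left-associated product.  For the second identity, associativity turns the
    product into a_k (x) (a_{k+1} (x) ... (x) a_T), and a_k (x) V_{k+1} = V_k
    because minimising over the successor state z and over the controls that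
    reach z is the same as minimising over all controls. *)
Require Import Defs.
From mathcomp Require Import all_boot all_order all_algebra.
From mathcomp Require Import boolp classical_sets reals ereal.
From mathcomp Require Import zify.
Import Order.TTheory GRing.Theory Num.Theory.
Local Open Scope classical_set_scope.
Local Open Scope ring_scope.

(** A finite [c] moves to the other side of the inequality. [M] excludes [c = -oo]; for [c = +oo],
    [N] keeps the infimum off [-oo], so the sum is [+oo]. An empty [B], as for an unreachable state,
    is covered. *)
Lemma le_adde_ereal_inf (R : realType) (c L : \bar R) (B : set (\bar R))
    (M N : R) :
  (M%:E <= c)%E -> lbound B N%:E -> (forall b, B b -> (L <= c + b)%E) ->
  (L <= c + ereal_inf B)%E.
Proof.
move=> Mc NB LB; have NB' : (N%:E <= ereal_inf B)%E by apply: le_ereal_inf_tmp.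
case: c Mc LB => [c||] // Mc LB; last first.
  by rewrite addye ?leey //; case: (ereal_inf B) NB'.
rewrite -leeBlDl //; apply: le_ereal_inf_tmp => b Bb.
by rewrite leeBlDl //; apply: LB.
Qed.

Lemma le_ereal_infD (R : realType) (L : \bar R) (A B : set (\bar R)) (M N : R) :
  lbound A M%:E -> lbound B N%:E ->
  (forall a b, A a -> B b -> (L <= a + b)%E) ->
  (L <= ereal_inf A + ereal_inf B)%E.
Proof.
move=> MA NB LAB; apply: (le_adde_ereal_inf _ _ _ _ M N) => //.
  exact: le_ereal_inf_tmp.
move=> b Bb; rewrite addeC; apply: (le_adde_ereal_inf _ _ _ _ N M) => //.
  exact: NB.
by move=> a Aa; rewrite addeC; apply: LAB.
Qed.

Section OtimesIter.
Context {R : realType} {X : Type}.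
Implicit Type a : int -> X -> X -> \bar R.

Lemma bounded_below_otimes_iter a (i : int) (m : nat) :
  (forall j : nat, (j <= m)%N -> bounded_below (a (i + j%:Z))) ->
  bounded_below (otimes_iter a i m).
Proof.
elim: m => [|m IHm] ab /=; first by have := ab 0%N isT; rewrite addr0.
by apply: bounded_below_otimes; [apply: IHm => j jm; apply: ab; lia | apply: ab].
Qed.

(** Products are bracketed to the left, whereas the backward recursion acts on the first factor.
    Induction pulls that factor out of all but the last, and [otimesA] then regroups; the bounds are
    there for [otimesA]. *)
Lemma otimes_iterSl a (i : int) (m : nat) :
  (forall j : nat, (j <= m.+1)%N -> bounded_below (a (i + j%:Z))) ->
  otimes_iter a i m.+1 = otimes (a i) (otimes_iter a (i + 1) m).
Proof.
elim: m => [//|m IHm] ab.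
have shift (j : nat) : i + 1 + j%:Z = i + j.+1%:Z by lia.
rewrite -[LHS]/(otimes (otimes_iter a i m.+1) (a (i + m.+2%:Z))).
rewrite IHm; last by move=> j jm; apply: ab; lia.
rewrite -otimesA /= ?shift //.
- by have := ab 0%N isT; rewrite addr0.
- apply: bounded_below_otimes_iter => j jm; rewrite shift; apply: ab; lia.
- exact: ab.
Qed.

End OtimesIter.

Section Bellman.
Context {R : realType} {X U : Type}.
Variables (f : int -> X -> U -> X) (ell : int -> X -> U -> R).

Lemma cond_value1 (k : int) (x y : X) :
  cond_value f ell k (k + 1) x y
  = ereal_inf [set (ell k x u)%:E | u in [set u | f k x u = y]].
Proof.
have k1 : absz (k + 1 - k)%R = 1%N by lia.
congr ereal_inf; apply/seteqP; split=> [_ [[s v] [/= sk sk1 dyn] <-]|_ [u fu <-]].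
  exists (v k); last by rewrite /running_cost k1 big_ord1 addr0 /= sk.
  by rewrite /= -sk -sk1 (dyn (k + 1)) ?addrK //; lia.
(* A control that leads from [x] to [y] becomes a trajectory that jumps from [x] to [y] right after
   time [k]. *)
exists (fun n => if n <= k then x else y, fun=> u).
  split=> /=; first by rewrite lexx.
    by have -> : (k + 1 <= k) = false by lia.
  move=> n kn; have -> : n = k + 1 by lia.
  by rewrite addrK lexx; have -> : (k + 1 <= k) = false by lia.
by rewrite /running_cost k1 big_ord1 addr0 /= lexx.
Qed.

Lemma bounded_below_cond_value1 (k : int) :
  has_lbound [set ell k xu.1 xu.2 | xu in [set: X * U]] ->
  bounded_below (cond_value f ell k (k + 1)).
Proof.
move=> [M Mell]; exists M => x y; rewrite cond_value1.
apply: le_ereal_inf_tmp => _ [u _ <-]; rewrite lee_fin.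
by apply: Mell; exists (x, u).
Qed.

Lemma running_cost_recr (S k : int) (su : (int -> X) * (int -> U)) : S <= k ->
  running_cost ell S (k + 1) su
  = running_cost ell S k su + ell k (su.1 k) (su.2 k).
Proof.
move=> Sk; rewrite /running_cost.
have -> : absz (k + 1 - S)%R = (absz (k - S)%R).+1 by lia.
by rewrite big_ord_recr /=; have -> : S + (absz (k - S)%R)%:Z = k by lia.
Qed.

(** Infima need not be attained, so each inequality is checked on arbitrary trajectories: one by
    gluing a step onto a trajectory that ends at time [k], the other by cutting at time [k]. *)
Lemma cond_value_recr (S k : int) : S <= k ->
  bounded_below (cond_value f ell S k) ->
  bounded_below (cond_value f ell k (k + 1)) ->
  cond_value f ell S (k + 1)
  = otimes (cond_value f ell S k) (cond_value f ell k (k + 1)).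
Proof.
move=> Sk [M bS] [N bk]; apply/funext => x; apply/funext => y.
apply/le_anti/andP; split; apply: le_ereal_inf_tmp.
  move=> _ [z _ <-]; rewrite cond_value1.
  apply: (le_ereal_infD _ _ _ _ M N).
  - move=> r Ar; apply: le_trans (bS x z) _; exact: ereal_inf_lbound.
  - move=> r Ar; apply: le_trans (bk z y) _; rewrite cond_value1.
    exact: ereal_inf_lbound.
  move=> _ _ [[s v] [/= sS sk dyn] <-] [u fu <-].
  (* The state switches after time [k] but the control already at time [k], since [u] drives the
     step from [k] to [k + 1]. *)
  set su := (fun n => if n <= k then s n else y, fun n => if n < k then v n else u).
  have -> : ((running_cost ell S k (s, v))%:E + (ell k z u)%:E)%E
      = (running_cost ell S (k + 1) su)%:E.
    rewrite running_cost_recr // EFinD /= lexx ltxx sk; congr (_%:E + _)%E.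
    apply: eq_bigr => j _ /=; have jk : S + (j : nat)%:Z < k.
      by have := ltn_ord j; lia.
    by rewrite jk ltW.
  apply: ereal_inf_lbound; exists su => //; split=> /=.
  - by rewrite Sk.
  - by have -> : (k + 1 <= k) = false by lia.
  move=> n Sn; have [nk|nk] := lerP n k.
    have -> : n - 1 <= k by lia.
    have -> : n - 1 < k by lia.
    by apply: dyn; lia.
  have -> : n = k + 1 by lia.
  by rewrite addrK lexx ltxx sk.
move=> _ [su [sS sk1 dyn] <-]; rewrite running_cost_recr // EFinD.
(* The intermediate state is the one that the trajectory visits at time [k]. *)
apply: (@le_trans _ _ (cond_value f ell S k x (su.1 k)
                       + cond_value f ell k (k + 1) (su.1 k) y)%E).
  by apply: ereal_inf_lbound; exists (su.1 k).
apply: leeD; first apply: ereal_inf_lbound.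
  by exists su => //; split=> // n Sn; apply: dyn; lia.
rewrite cond_value1; apply: ereal_inf_lbound; exists (su.2 k) => //=.
by rewrite -sk1 (dyn (k + 1)) ?addrK //; lia.
Qed.

Lemma otimes_value (T k : int) (ellT : X -> R) : k < T ->
  bounded_below (cond_value f ell k (k + 1)) ->
  bounded_below (fun x (_ : X) => value T f ell ellT (k + 1) x) ->
  otimes (cond_value f ell k (k + 1))
    (fun x _ => value T f ell ellT (k + 1) x)
  = (fun x _ => value T f ell ellT k x).
Proof.
move=> kT [M bk] [N bV]; apply/funext => x; apply/funext => y.
rewrite value_rec //; apply/le_anti/andP; split; apply: le_ereal_inf_tmp.
  move=> _ [u _ <-].
  (* The intermediate state is the successor that [u] produces. *)
  apply: (@le_trans _ _ (cond_value f ell k (k + 1) x (f k x u)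
                         + value T f ell ellT (k + 1) (f k x u))%E).
    by apply: ereal_inf_lbound; exists (f k x u).
  by rewrite leeD2r // cond_value1; apply: ereal_inf_lbound; exists u.
move=> _ [z _ <-]; rewrite addeC cond_value1.
apply: (le_adde_ereal_inf _ _ _ _ N M); first exact: (bV z z).
  move=> r Ar; apply: le_trans (bk x z) _; rewrite cond_value1.
  exact: ereal_inf_lbound.
by move=> _ [u <- <-]; rewrite addeC; apply: ereal_inf_lbound; exists u.
Qed.

(** [otimes_iter] at [m] has [m.+1] factors, hence the final time [S + m.+1]. *)
Lemma otimes_iter_cond_value (T S : int) (ellT : X -> R) (m : nat) :
  S + m.+1%:Z <= T ->
  (forall n, S <= n < T -> bounded_below (cond_value f ell n (n + 1))) ->
  otimes_iter (element T f ell ellT) S m = cond_value f ell S (S + m.+1%:Z).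
Proof.
have elementE n : n < T -> element T f ell ellT n = cond_value f ell n (n + 1).
  by move=> nT; rewrite /element ifN_eq //; lia.
move=> mT bd; elim: m mT => [|m IHm] mT /=.
  by rewrite elementE //; lia.
have bS : bounded_below (cond_value f ell S (S + m.+1%:Z)).
  (* The bound on the multi-step cost comes from its being a product of one-step costs, each bounded
     below. *)
  rewrite -IHm; last lia.
  apply: bounded_below_otimes_iter => j jm; rewrite elementE; last lia.
  by apply: bd; lia.
have bm : bounded_below
    (cond_value f ell (S + m.+1%:Z) (S + m.+1%:Z + 1)) by apply: bd; lia.
rewrite IHm; last lia.
rewrite elementE; last lia.
by rewrite -cond_value_recr //; [congr cond_value; lia | lia].
Qed.

Lemma otimes_iter_value (T : int) (ellT : X -> R) (m : nat) :
  (forall n, T - m%:Z <= n <= T -> bounded_below (element T f ell ellT n)) ->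
  otimes_iter (element T f ell ellT) (T - m%:Z) m
  = (fun x _ => value T f ell ellT (T - m%:Z) x).
Proof.
elim: m => [|m IHm] bd; first by rewrite /= subr0 /element eqxx.
have kS : T - m.+1%:Z + 1 = T - m%:Z by lia.
have bdm n : T - m%:Z <= n <= T -> bounded_below (element T f ell ellT n).
  by move=> mn; apply: bd; lia.
rewrite otimes_iterSl; last by move=> j jm; apply: bd; lia.
rewrite kS (IHm bdm).
have elementE : element T f ell ellT (T - m.+1%:Z)
    = cond_value f ell (T - m.+1%:Z) (T - m.+1%:Z + 1).
  by rewrite /element ifN_eq //; lia.
rewrite elementE -kS otimes_value //; first lia.
  by rewrite -elementE; apply: bd; lia.
(* Likewise, the value function is bounded below because the induction hypothesis makes it a product
   of such elements. *)
rewrite kS -(IHm bdm); apply: bounded_below_otimes_iter => j jm.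
by apply: bdm; lia.
Qed.

End Bellman.

Theorem theorem5 (R : realType) (X U : Type) (S T : int) (hST : S < T)
    (f : int -> X -> U -> X)
    (ell : int -> X -> U -> R) (ellT : X -> R)
    (ell_lb : forall n : int, S <= n < T ->
       has_lbound [set ell n xu.1 xu.2 | xu in [set: X * U]])
    (ellT_lb : has_lbound [set ellT x | x in [set: X]]) :
  (forall k : int, S + 1 <= k <= T ->
     otimes_prod (element T f ell ellT) S (k - 1) = cond_value f ell S k) /\
  (forall k : int, S <= k <= T ->
     otimes_prod (element T f ell ellT) k T
     = (fun x _ => value T f ell ellT k x)).
Proof.
have bd n : S <= n < T -> bounded_below (cond_value f ell n (n + 1)).
  by move=> Sn; apply: bounded_below_cond_value1; apply: ell_lb.
split=> k kT; rewrite /otimes_prod.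
  rewrite otimes_iter_cond_value //; last lia.
  by congr cond_value; lia.
(* Writing [k] as [T] minus a natural number matches the induction on the number of remaining
   steps. *)
have kE : T - (absz (T - k)%R)%:Z = k by lia.
rewrite -[in LHS]kE -[in RHS]kE subKr; apply: otimes_iter_value => n kn.
rewrite /element; case: eqVneq => [_|nT]; last by apply: bd; lia.
have [M MellT] := ellT_lb; exists M => x _.
by rewrite value_last lee_fin; apply: MellT; exists x.
Qed.
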